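(* Let $q$ be an odd prime power and $d$ a positive integer, and suppose that either $q\equiv 1 \pmod 4$ and $d$ is even, or $q\equiv 3\pmod 4$ and $d\equiv 0\pmod 4$. Then there exists a subset $\mathcal{P}\subseteq\mathbb{F}_q^d$ with $|\mathcal{P}|=q^{d/2}$ such that no spread is determined by points of $\mathcal{P}$.
   Context: For $\mathbf{u},\mathbf{v}\in\mathbb{F}_q^d$, $\mathbf{u}\cdot\mathbf{v}=\sum_{i=1}^d u_iv_i$ and $\|\mathbf{x}\|=\mathbf{x}\cdot\mathbf{x}$. For points $\mathbf{a},\mathbf{b},\mathbf{c}\in\mathbb{F}_q^d$, the spread $S(\mathbf{b},\mathbf{a},\mathbf{c})$ is $$S(\mathbf{b},\mathbf{a},\mathbf{c})=1-\frac{((\mathbf{b}-\mathbf{a})\cdot(\mathbf{c}-\mathbf{a}))^2}{\|\mathbf{b}-\mathbf{a}\|\,\|\mathbf{c}-\mathbf{a}\|},$$ undefined if either factor in the denominator is $0$. The spreads determined by $\mathcal{P}$ are the values $S(\mathbf{b},\mathbf{a},\mathbf{c})$ over all $\mathbf{a},\mathbf{b},\mathbf{c}\in\mathcal{P}$ for which it is defined; ''no spread is determined'' means the spread is undefined for every such triple. *)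

(* Defs.v *)
From mathcomp Require Import all_boot all_algebra.

Set Implicit Arguments.
Unset Strict Implicit.
Unset Printing Implicit Defensive.

Import GRing.Theory.
Local Open Scope ring_scope.

Definition dot (F : fieldType) (d : nat) (u v : 'rV[F]_d) : F :=
  \sum_(i < d) u ord0 i * v ord0 i.

(* Following the convention of the subject, this is x . x, with no square
   root. *)
Definition norm (F : fieldType) (d : nat) (x : 'rV[F]_d) : F := dot x x.

(* [None] means that the spread is undefined. *)
Definition spread (F : fieldType) (d : nat) (b a c : 'rV[F]_d) : option F :=
  if (norm (b - a) != 0) && (norm (c - a) != 0)
  then Some (1 - dot (b - a) (c - a) ^+ 2 / (norm (b - a) * norm (c - a)))
  else None.

Definition no_spread_determined (F : finFieldType) (d : nat)
    (P : {set 'rV[F]_d}) : Prop :=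
  forall a b c : 'rV[F]_d,
    a \in P -> b \in P -> c \in P -> spread b a c = None.

(* Main.v *)
Require Import Defs.
From mathcomp Require Import all_boot all_algebra all_field.
From mathcomp Require Import ring zify.

Set Implicit Arguments.
Unset Strict Implicit.
Unset Printing Implicit Defensive.

Import GRing.Theory.
Local Open Scope ring_scope.

(** The set [P] is a totally isotropic subspace of dimension [n = d / 2]: all
    differences of its points have norm [0]. It is the row space of [(1 | A)]
    for a square matrix [A] with [A A^T = -1]. Such an [A] exists as a scalar
    matrix when [-1] is a square, and when [n] is even as
    [[a, b], [-b, a]] (in scalar blocks) with [a^2 + b^2 = -1]. *)

(** With [#|F| = 4k + 1], the polynomial [X^(2k) - 1] has too few roots to vanish at all [4k]
    nonzero elements. Where it does not vanish, [x ^+ (2 * k)] is a square root of [1] other than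
    [1], hence [-1]. *)
Lemma finField_N1_square (F : finFieldType) :
  (#|F| = 1 %[mod 4])%N -> exists i : F, i ^+ 2 = -1.
Proof.
move=> F_mod4; set k := (#|F| %/ 4)%N.
have F_gt1 := finNzRing_gt1 F.
have cardF : #|F| = (4 * k).+1 by rewrite /k; lia.
have k_gt0 : (0 < k)%N by move: F_gt1; rewrite cardF; lia.
have sizep : size ('X^(2 * k) - 1%:P : {poly F}) = (2 * k).+1.
  by rewrite size_XnsubC // muln_gt0.
have p_neq0 : 'X^(2 * k) - 1%:P != 0 :> {poly F} by rewrite -size_poly_eq0 sizep.
have [x x_neq0 xk_neq1] : exists2 x : F, x != 0 & x ^+ (2 * k) != 1.
  apply/exists_inP; apply: contraT; rewrite negb_exists_in => /forall_inP all1.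
  have := max_poly_roots (rs := enum [pred x : F | x != 0]) p_neq0.
  rewrite enum_uniq sizep -cardE cardC1 cardF ltnS => /(_ _ isT).
  suff -> : all (root ('X^(2 * k) - 1%:P)) (enum [pred x : F | x != 0]).
    by move=> /(_ isT); lia.
  apply/allP => x; rewrite mem_enum inE => /all1; rewrite negbK => /eqP xk1.
  by rewrite rootE !hornerE xk1 subrr.
exists (x ^+ k); apply/eqP; rewrite -exprM mulnC.
have /eqP : (x ^+ (2 * k)) ^+ 2 = 1.
  apply: (mulfI x_neq0); rewrite mulr1 -exprM -exprS.
  by rewrite -[RHS]expf_card cardF; congr (_ ^+ _); lia.
by rewrite sqrf_eq1 (negbTE xk_neq1).
Qed.

(** Each fibre of squaring lies in some [[set r; - r]]. *)
Lemma card_squares (F : finFieldType) :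
  (#|F| <= 2 * #|[set x ^+ 2 | x : F]|)%N.
Proof.
rewrite -[#|F|]sum1_card.
rewrite (partition_big_imset (fun x : F => x ^+ 2)) /=.
rewrite mulnC -sum_nat_const; apply: leq_sum => _ /imsetP[r _ ->].
rewrite sum1dep_card (leq_trans _ (_ : #|[set r; - r]| <= 2)%N) //.
  by apply/subset_leq_card/subsetP => x; rewrite !inE /= eqf_sqr.
by rewrite cards2; case: (_ != _).
Qed.

(* The squares and the set [-1 - squares] each fill more than half of [F], so
   they meet. *)
Lemma finField_N1_sum2_squares (F : finFieldType) :
  odd #|F| -> exists a b : F, a ^+ 2 + b ^+ 2 = -1.
Proof.
move=> q_odd; set S := [set x ^+ 2 | x : F].
have cardS := card_squares F; rewrite -/S in cardS.
pose T := [set -1 - s | s in S].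
have cardT : #|T| = #|S| by apply: card_imset; exact: (can_inj (subKr _)).
have [|ST0] := boolP (S :&: T != set0).
  case/set0Pn => x /setIP[/imsetP[a _ xa] /imsetP[_ /imsetP[b _ ->] xb]].
  by exists a, b; rewrite -xa xb subrK.
(* Disjointness would give [2 * #|S| <= #|F|], hence equality by [cardS], against the oddness of
   [#|F|]. *)
have := cardsUI S T; rewrite (eqP (negbNE ST0)) cards0 cardT.
have : (#|S :|: T| <= #|F|)%N by exact: max_card.
move: q_odd cardS; lia.
Qed.

Lemma dot_mulmx_tr (F : fieldType) d (u v : 'rV[F]_d) :
  dot u v = (u *m v^T) ord0 ord0.
Proof. by rewrite mxE; apply: eq_bigr => i _; rewrite mxE. Qed.

Lemma no_spread_of_antiorthogonal (F : finFieldType) n (A : 'M[F]_n) :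
  A *m A^T = (-1)%:M ->
  exists P : {set 'rV[F]_(n + n)},
    #|P| = (#|F| ^ n)%N /\ no_spread_determined P.
Proof.
move=> AAT; pose M : 'M_(n, n + n) := row_mx 1%:M A.
exists [set v *m M | v : 'rV[F]_n]; split.
  (* The identity block of [M] makes [v *m M] determine [v]. *)
  rewrite card_imset ?card_mx ?mul1n // => u v.
  by rewrite !mul_mx_row !mulmx1 => /eq_row_mx[].
move=> _ _ c /imsetP[u _ ->] /imsetP[v _ ->] _.
(* The norm of a difference is [w *m (M *m M^T) *m w^T] with [w = v - u], and
   [M *m M^T = 1 + A *m A^T = 0]. *)
rewrite /spread /norm -mulmxBl dot_mulmx_tr trmx_mul mulmxA -(mulmxA _ M).
rewrite tr_row_mx mul_row_col trmx1 mulmx1 AAT.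
by rewrite -raddfD /= subrr raddf0 mulmx0 mul0mx mxE eqxx.
Qed.

Lemma antiorthogonal_scalar (F : fieldType) n (i : F) :
  i ^+ 2 = -1 -> (i%:M : 'M_n) *m (i%:M)^T = (-1)%:M.
Proof. by move=> <-; rewrite tr_scalar_mx -scalar_mxM. Qed.

Lemma antiorthogonal_block (F : fieldType) n (a b : F) :
  a ^+ 2 + b ^+ 2 = -1 ->
  let A : 'M_(n + n) := block_mx a%:M b%:M (- b)%:M a%:M in
  A *m A^T = (-1)%:M.
Proof.
move=> ab /=; rewrite tr_block_mx !tr_scalar_mx mulmx_block -!scalar_mxM.
rewrite -!raddfD /= -ab scalar_mx_block.
(* Writing the zero off-diagonal blocks as scalar matrices reduces every block to an identity in
   [F]. *)
by congr block_mx; rewrite -?(raddf0 (@scalar_mx F n)); congr scalar_mx; ring.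
Qed.

Local Close Scope ring_scope.

Theorem theorem1p6 (F : finFieldType) (d : nat)
    (q_odd : odd #|F|) (d_gt0 : 0 < d)
    (hqd : (#|F| = 1 %[mod 4] /\ ~~ odd d)
        \/ (#|F| = 3 %[mod 4] /\ d = 0 %[mod 4])) :
  exists P : {set 'rV[F]_d},
    #|P| = #|F| ^ (d %/ 2) /\ no_spread_determined P.
Proof.
set n := (d %/ 2)%N.
have dE : d = (n + n)%N by rewrite /n; lia.
suff [A AAT] : exists A : 'M[F]_n, (A *m A^T = (-1)%:M)%R.
  (* Forgetting that [n] is defined from [d] lets [d] be replaced by [n + n] in the type of the row
     vectors. *)
  by clearbody n; subst d; apply: no_spread_of_antiorthogonal AAT.
case: hqd => [[/finField_N1_square[i i2] _]|[_ d_mod4]].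
  by exists (i%:M)%R; apply: antiorthogonal_scalar.
have [a [b ab]] := finField_N1_sum2_squares q_odd.
have nE : n = (n %/ 2 + n %/ 2)%N by lia.
rewrite nE; eexists; exact: antiorthogonal_block ab.
Qed.
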